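(* Let $G$ be a finite group such that the difference subgroup graph $D(G)$ has at least one edge and the independence number of $D(G)$ is at most $14$. Then $G$ is solvable.
   Context: For a finite group $G$, the difference subgroup graph $D(G)$ is the undirected graph whose vertices are the non-trivial proper subgroups of $G$, with two distinct vertices $H$ and $K$ adjacent if and only if $\langle H,K\rangle = G$ and $HK\neq G$, where $HK=\{hk : h\in H,\ k\in K\}$. The independence number $\alpha(D(G))$ is the size of a largest set of pairwise non-adjacent vertices of $D(G)$. *)

(* Defs.v *)
From mathcomp Require Import all_boot all_fingroup all_solvable.

Set Implicit Arguments.
Unset Strict Implicit.
Unset Printing Implicit Defensive.

Local Open Scope group_scope.

Definition dsg_vertices (gT : finGroupType) (G : {group gT}) :
    {set {group gT}} :=
  [set H : {group gT} | (H \proper G) && (H :!=: 1)].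

(* [H * K] is the product set, in general not a group, so it is compared
   with [G] in [{set gT}]. *)
Definition dsg_adj (gT : finGroupType) (G : {group gT}) : rel {group gT} :=
  fun H K => [&& H \in dsg_vertices G, K \in dsg_vertices G, H != K,
                 H <*> K :==: G & H * K :!=: G].

Definition independent (T : finType) (V : {set T}) (e : rel T)
    (S : {set T}) : bool :=
  (S \subset V) && [forall x in S, forall y in S, ~~ e x y].

Definition independence_number (T : finType) (V : {set T}) (e : rel T) : nat :=
  \max_(S : {set T} | independent V e S) #|S|.

(* Main.v *)
(* By induction on |G|, a nonsolvable group has 15 pairwise non-adjacent
   vertices. If 1 < N < G is normal, either G / N is nonsolvable and an
   independent set of D(G / N) lifts to D(G), or N is nonsolvable and its
   subgroups, all contained in N, are pairwise non-adjacent.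

   So let G be simple, with at most 14 involutions (two involutions generate a
   dihedral, hence solvable, group, so the subgroups of order 2 are pairwise
   non-adjacent) and at most 14 nontrivial subgroups in each proper subgroup.
   Let P be a Sylow p-subgroup for the least prime p dividing |G|. Burnside's
   transfer argument shows that P is not cyclic; then counting subgroups of
   normalizers of Sylow intersections shows that distinct Sylow p-subgroups
   meet trivially.

   For p odd, P / Phi(P) has order at most p^2, so that p'-elements of N_G(P)
   centralize P: the fusion of P is controlled by P itself, and the transfer
   into P / P' gives P = 1. For p = 2, the number k of Sylow 2-subgroups is 1
   mod |P|, and G has k times as many involutions as P: for |P| = 4 this is at
   least 5 * 3, for |P| >= 16 at least 17, and if |P| = 8 then k = 9 and an
   element of prime order q > 3 would fix all nine Sylow 2-subgroups. *)
Require Import Defs.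
From mathcomp Require Import all_boot all_fingroup all_solvable.
From mathcomp Require Import all_algebra all_character zify.

Set Implicit Arguments.
Unset Strict Implicit.
Unset Printing Implicit Defensive.

Import GroupScope FiniteModule.

(** * Independent sets from proper subgroups and from quotients *)

Definition nontrivial_subgroups (gT : finGroupType) (G : {group gT}) :
    {set {group gT}} :=
  [set H : {group gT} | (H \subset G) && (H :!=: 1)].

Definition wide (gT : finGroupType) (G : {group gT}) : Prop :=
  exists2 S : {set {group gT}},
    independent (dsg_vertices G) (dsg_adj G) S & 14 < #|S|.

Lemma wide_independence (gT : finGroupType) (G : {group gT}) :
  wide G -> 14 < independence_number (dsg_vertices G) (dsg_adj G).
Proof. by case=> S indS ltS; apply: leq_trans ltS (leq_bigmax_cond _ indS). Qed.

Lemma wide_nontrivial_subgroups (gT : finGroupType) (G : {group gT}) :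
  wide G -> 14 < #|nontrivial_subgroups G|.
Proof.
case=> S /andP[sSV _] ltS; apply: leq_trans ltS (subset_leq_card _).
apply: subset_trans sSV _; apply/subsetP=> H; rewrite !inE.
by case/andP=> /proper_sub-> ->.
Qed.

(** All non-trivial subgroups of [H], including [H] itself, are vertices for [G], and their joins
    stay inside [H]. *)
Lemma wide_proper (gT : finGroupType) (G H : {group gT}) :
  H \proper G -> 14 < #|nontrivial_subgroups H| -> wide G.
Proof.
move=> prH ltH; exists (nontrivial_subgroups H) => //; apply/andP; split.
  apply/subsetP=> K; rewrite !inE => /andP[sKH ->].
  by rewrite (sub_proper_trans sKH).
apply/forall_inP=> K /[!inE] /andP[sKH _].
apply/forall_inP=> L /[!inE] /andP[sLH _].
apply/negP=> /and5P[_ _ _ /eqP defG _].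
by have := proper_subn prH; rewrite -defG join_subG sKH sLH.
Qed.

Lemma cosetpre_group_inj (gT : finGroupType) (N : {group gT}) :
  injective (fun H : {group coset_of N} => coset N @*^-1 H)%G.
Proof.
move=> H K eqf; apply: val_inj; rewrite /= -[LHS]cosetpreK -[RHS]cosetpreK.
exact: (congr1 (fun L : {group gT} => L / N) eqf).
Qed.

Lemma card_nontrivial_subgroups_quotient (gT : finGroupType)
    (G N : {group gT}) :
  N <| G -> #|nontrivial_subgroups (G / N)| <= #|nontrivial_subgroups G|.
Proof.
move=> nsNG; rewrite -(card_imset _ (@cosetpre_group_inj _ N)).
apply/subset_leq_card/subsetP=> _ /imsetP[H HG ->].
move: HG; rewrite !inE => /andP[sHG ntH] /=.
rewrite sub_cosetpre_quo // sHG; apply: contra ntH => /eqP f1.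
by rewrite -(cosetpreK H) f1 quotient1.
Qed.

(** Preimages under G -> G / N commute with joins and with products of subgroups, so an edge between
    two preimages would descend to an edge of D(G / N). *)
Lemma wide_quotient (gT : finGroupType) (G N : {group gT}) :
  N <| G -> wide (G / N) -> wide G.
Proof.
move=> nsNG [S /andP[sSV /forall_inP indS] ltS].
pose f (H : {group coset_of N}) := (coset N @*^-1 H)%G.
exists (f @: S); last by rewrite card_imset //; apply: cosetpre_group_inj.
have fV H : H \in S -> f H \in dsg_vertices G.
  move/(subsetP sSV); rewrite !inE => /andP[prH ntH].
  rewrite -(quotientGK nsNG) /= cosetpre_proper prH.
  by apply: contra ntH => /eqP f1; rewrite -(cosetpreK H) f1 quotient1.
apply/andP; split; first by apply/subsetP=> _ /imsetP[H SH ->]; apply: fV.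
apply/forall_inP=> _ /imsetP[H SH ->]; apply/forall_inP=> _ /imsetP[K SK ->].
have /forall_inP/(_ K SK) := indS H SH; apply: contra.
case/and5P=> _ _ neHK /eqP defG neqG.
rewrite /dsg_adj (subsetP sSV) // (subsetP sSV) //=; apply/and3P; split.
- by apply: contra neHK => /eqP->.
- by rewrite -[in X in _ == X]defG quotientY ?subsetIl //= ?cosetpreK //; apply/eqP.
apply: contra neqG => /eqP defHK.
by rewrite /= -cosetpreM defHK quotientGK.
Qed.

(** * Involutions and dihedral subgroups *)

Definition involutions (gT : finGroupType) (A : {set gT}) : {set gT} :=
  [set x in A | #[x] == 2].

(** The involution [x] inverts [x * y], so the group generated is an extension of the normal cyclic
    group of [x * y] by a cyclic group. *)
Lemma involutions_sol (gT : finGroupType) (x y : gT) :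
  #[x] = 2 -> #[y] = 2 -> solvable (<[x]> <*> <[y]>).
Proof.
move=> ox oy; pose N := <[x * y]>%G.
have xV : x^-1 = x by apply/eqP; rewrite eq_invg_mul -expg2 -ox expg_order.
have yV : y^-1 = y by apply/eqP; rewrite eq_invg_mul -expg2 -oy expg_order.
have nNx : <[x]> \subset 'N(N).
  rewrite cycle_subG; apply/normP; rewrite /= -cycleJ conjgE xV -[N : {set _}]cycleV.
  by rewrite invMg xV yV !mulgA -{1}xV mulVg mul1g.
have defG : <[x]> <*> <[y]> = <[x]> <*> N.
  apply/eqP; rewrite eqEsubset !join_subG !joing_subl !cycle_subG /=.
  apply/andP; split.
    by rewrite -{1}(mulKg x y) xV groupM ?mem_gen ?inE ?cycle_id ?orbT.
  by rewrite groupM ?mem_gen ?inE ?cycle_id ?orbT.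
rewrite defG (series_sol (H := N)) ?normalYr // ?(abelian_sol (cycle_abelian _)) /=.
  by rewrite quotientYidr // !abelian_sol ?quotient_abelian ?cycle_abelian.
Qed.

Lemma wide_involutions (gT : finGroupType) (G : {group gT}) :
  ~~ solvable G -> 14 < #|involutions G| -> wide G.
Proof.
move=> nsolG ltI; pose S := [set <[x]>%G | x in involutions G].
exists S; last first.
  rewrite card_in_imset // => x y; rewrite !inE.
  case/andP=> _ /eqP ox /andP[_ /eqP oy] /(congr1 val) /= exy.
  have : x \in <[y]> by rewrite -exy cycle_id.
  rewrite cycle2g // !inE => /orP[/eqP x1|/eqP//].
  by rewrite x1 order1 in ox.
have SV x : x \in involutions G -> <[x]>%G \in dsg_vertices G.
  rewrite !inE properEneq cycle_subG => /andP[Gx /eqP ox]; rewrite Gx andbT /=.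
  rewrite cycle_eq1 -order_eq1 ox andbT.
  by apply: contra nsolG => /eqP<-; rewrite abelian_sol ?cycle_abelian.
apply/andP; split; first by apply/subsetP=> _ /imsetP[x Ix ->]; apply: SV.
apply/forall_inP=> _ /imsetP[x Ix ->]; apply/forall_inP=> _ /imsetP[y Iy ->].
apply: contra nsolG => /and5P[_ _ _ /eqP<- _].
move: Ix Iy; rewrite !inE => /andP[_ /eqP ox] /andP[_ /eqP oy].
exact: involutions_sol.
Qed.

(** * Transfer into the abelianization of a Sylow subgroup *)

(* Each factor of the transfer V(x) is a conjugate of a power of x lying in P,
   so modulo P' the hypothesis gives V(x) = x^|G : P|; and V vanishes on G'. *)
Lemma transfer_control (gT : finGroupType) (p : nat) (G P : {group gT}) :
    p.-Sylow(G) P ->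
    (forall x g, x \in P -> g \in G -> x ^ g \in P ->
       coset P^`(1) (x ^ g) = coset P^`(1) x) ->
  P \subset G^`(1) -> P :=: 1.
Proof.
move=> sylP fusP sPG'; have [sPG pP _] := and3P sylP.
have nP'P : P \subset 'N(P^`(1)) by apply: der_norm.
pose alpha := restrm_morphism nP'P (coset_morphism P^`(1)).
have abA : abelian (alpha @* P).
  by rewrite morphim_restrm setIid -quotientE der_abelian.
apply/eqP/negPn/negP => ntP.
(* Choose [x] in P outside P'; the transfer will show that it lies in P' after all. *)
have /properP[_ [x Px]] := sol_der1_proper (pgroup_sol pP) (subxx _) ntP.
case/negP; have Gx := subsetP sPG x Px.
have tr1 : transfer G abA x = 0%R.
  pose f := transfer_morphism G abA.
  have : f x \in f @* G^`(1).
    by rewrite mem_morphim ?(subsetP sPG') //= (subsetP (der_sub _ _)) ?(subsetP sPG').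
  by rewrite morphim_der // (derG1P (FinRing.zmod_abelian _)) => /set1P.

have trX := transversalP (rcosets_cycle_partition sPG Gx).
set X := transversal _ _ in trX.
rewrite (transfer_cycle_expansion sPG abA Gx trX) in tr1.
pose fm z := fmod abA (coset P^`(1) z).
have imP y : y \in P -> coset P^`(1) y \in alpha @* P.
  by move=> Py; apply: (mem_morphim alpha).
have fmM : {in P &, {morph fm : y z / (y * z)%g >-> (y + z)%R}}.
  by move=> y z Py Pz; rewrite /fm morphM ?(subsetP nP'P) // fmodM ?imP.
have fmX n y : y \in P -> fm (y ^+ n) = (fm y *+ n)%R.
  move=> Py; elim: n => [|n IHn]; last by rewrite expgS fmM ?groupX // IHn GRing.mulrS.
  by rewrite /fm morph1 fmod1.
have tr2 : (fm x *+ #|G : P|)%R = 0%R.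
  rewrite -tr1 -(sum_index_rcosets_cycle sPG Gx trX) -GRing.sumrMnr.
  apply: eq_bigr => y Xy; rewrite -fmX //.
  set n := #|_ : _|.
  have Gy : y \in G by apply: (subsetP (transversal_sub trX)).
  have Pxy : (x ^+ n) ^ y^-1 \in P.
    rewrite conjgE invgK mulgA -mem_rcoset.
    exact: mulg_exp_card_rcosets.
  by rewrite /fm -(fusP (x ^+ n) y^-1) ?groupX ?groupV.
have tr3 : (fm x *+ #|P|)%R = 0%R.
  by rewrite -fmX // expg_cardG // /fm morph1 fmod1.
(* The image of [x] in P / P' is killed by two coprime integers, hence is zero by Bezout. *)
have co : coprime #|G : P| #|P|.
  by rewrite coprime_sym; have := pHall_Hall sylP => /andP[].
have fx0 : fm x = 0%R.
  have [u v] := egcdnP #|P| (indexg_gt0 G P).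
  rewrite (eqP co) => e _.
  rewrite -[fm x]GRing.mulr1n; apply: (@GRing.addIr _ (fm x *+ (v * #|P|))%R).
  rewrite -GRing.mulrnDr addnC -e ![(_ * #|_|)%N]mulnC !GRing.mulrnA tr2 tr3.
  by rewrite !GRing.mul0rn GRing.addr0.
apply: coset_idr; first exact: (subsetP nP'P).
have : val (fm x) = 1 by rewrite fx0 fmval0.
by rewrite fmodK ?imP.
Qed.

(** * Counting subgroups: maximal subgroups, Sylow intersections, elementary abelian groups *)

(* R is the union of its maximal subgroups; they have index p and all contain
   1, so p of them cannot cover R. *)
Lemma card_maximal_noncyclic (gT : finGroupType) (p : nat) (R : {group gT}) :
    p.-group R -> ~~ cyclic R ->
  p < #|[set A : {group gT} | maximal A R]|.
Proof.
move=> pR ncR; set M := [set A | _].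
have ntR : R :!=: 1 by apply: contraNneq ncR => ->; apply: cyclic1.
have [p_pr _ _] := pgroup_pdiv pR ntR.
have cardM (A : {group gT}) : A \in M -> (p * #|A^#| + p = #|R|)%N.
  rewrite inE => maxA; have [sAR _] := andP (maxgroupp maxA).
  rewrite -(Lagrange sAR) (p_maximal_index pR maxA) (cardsD1 1 A) group1.
  by rewrite add1n mulSn mulnC addnC.
have covR : R^# \subset \bigcup_(A in M) A^#.
  apply/subsetP=> x /setD1P[nt_x Rx]; apply/bigcupP.
  have sxR : <[x]> \subset R by rewrite cycle_subG.
  have [defR|[A maxA sxA]] := maximal_exists sxR.
    by case/negP: ncR; rewrite -defR cycle_cyclic.
  by exists A; rewrite !inE ?nt_x -?cycle_subG.
rewrite ltnNge; apply/negP=> leMp.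
have: #|R^#| <= \sum_(A in M) #|A^#|.
  apply: leq_trans (subset_leq_card covR) _.
  elim/big_rec2: _ => [|A n B _ IH]; first by rewrite cards0.
  by apply: leq_trans (leq_card_setU _ _) _; rewrite leq_add2l.
(* Multiplied by p, the sum is at most p (|R| - p), which is less than p (|R| - 1). *)
rewrite leqNgt => /negP[]; rewrite -(ltn_pmul2l (prime_gt0 p_pr)) big_distrr /=.
rewrite (eq_bigr (fun _ => #|R| - p)%N) => [|A /cardM <-]; last by rewrite addnK.
rewrite sum_nat_const (@leq_ltn_trans (p * (#|R| - p))) ?leq_mul2r ?leMp ?orbT //.
have cR1 : #|R| = #|R^#|.+1 by rewrite (cardsD1 1 R) group1.
have : 1 < #|R| by rewrite cardG_gt1.
rewrite ltn_pmul2l ?prime_gt0 // cR1; move: #|R^#| (prime_gt1 p_pr) => n.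
by lia.
Qed.

(* A Sylow subgroup has at least p maximal subgroups other than D, none of them
   contained in another Sylow subgroup; with the Sylow subgroups and D itself
   this gives the count. *)
Lemma card_psubgroups_TI (gT : finGroupType) (p : nat) (N D : {group gT}) :
    prime p -> D :!=: 1 -> 1 < #|'Syl_p(N)| ->
    {in 'Syl_p(N), forall R : {group gT}, ~~ cyclic R} ->
    (forall R1 R2 : {group gT}, R1 \in 'Syl_p(N) -> R2 \in 'Syl_p(N) ->
       R1 != R2 -> R1 :&: R2 = D) ->
  #|'Syl_p(N)| * p.+1 < #|[set H in nontrivial_subgroups N | p.-group H]|.
Proof.
move=> p_pr ntD gtS1 ncS tiS.
have prD R : R \in 'Syl_p(N) -> D \proper R.
  move=> SR; have [R' SR' neR] : exists2 R', R' \in 'Syl_p(N) & R' != R.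
    move: gtS1; rewrite (cardsD1 R) SR ltnS card_gt0 => /set0Pn[R' /setD1P[]].
    by exists R'.
  rewrite -(tiS R R') // 1?eq_sym // properE subsetIl subsetI subxx /=.
  apply: contra neR => sRR'; rewrite eq_sym -val_eqE eqEcard sRR'.
  move: SR SR'; rewrite !inE => /card_Hall eR /card_Hall eR'.
  by rewrite /= eR eR'.
pose U (R : {group gT}) : {set {group gT}} :=
  R |: [set A : {group gT} | maximal A R] :\ D.
have cardU R : R \in 'Syl_p(N) -> p.+1 <= #|U R|.
  move=> SR; have pR : p.-group R by move: SR; rewrite inE => /pHall_pgroup.
  have := card_maximal_noncyclic pR (ncS R SR).
  rewrite cardsU1 (cardsD1 D) !inE.
  have -> : maximal R R = false.
    by apply/negP=> /maxgroupp/proper_subn; rewrite subxx.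
  rewrite andbF /=.
  by move/leq_trans; apply; rewrite leq_add2r leq_b1.
have sUR R A : A \in U R -> A \subset R.
  by rewrite !inE => /orP[/eqP-> //|/andP[_ /maxgroupp/proper_sub]].
have notUD R A : R \in 'Syl_p(N) -> A \in U R -> ~~ (A \subset D).
  move=> SR; rewrite !inE => /orP[/eqP-> |/andP[neAD maxA]].
    by rewrite proper_subn ?prD.
  apply: contra neAD => sAD; have /maxgroupP[_ maxA'] := maxA.
  by rewrite -val_eqE /= (maxA' D) ?prD.
pose S := [set u : {group gT} * {group gT} | (u.1 \in 'Syl_p(N)) && (u.2 \in U u.1)].
have cardS : #|'Syl_p(N)| * p.+1 <= #|S|.
  have -> : #|S| = \sum_(R in 'Syl_p(N)) \sum_(A in U R) 1.
    by rewrite pair_big_dep /= -sum1_card; apply: eq_bigl => u; rewrite !inE.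
  by rewrite -sum_nat_const leq_sum // => R SR; rewrite sum1_card cardU.
(* A subgroup counted for two Sylow subgroups would lie in their intersection D, which [notUD]
   excludes. *)
have injS : {in S &, injective snd}.
  move=> [R1 A] [R2 B] /[1!in_set] /= /andP[SR1 UA] /[1!in_set] /= /andP[SR2 UB] eqAB.
  rewrite -{}eqAB in UB *; congr (_, _); apply/eqP/negPn/negP => neR.
  case/negP: (notUD _ _ SR1 UA); by rewrite -(tiS R1 R2) // subsetI (sUR R1) ?(sUR R2).
rewrite -(card_in_imset injS) in cardS; apply: leq_ltn_trans cardS _.
have [R0 SR0] : exists R0, R0 \in 'Syl_p(N).
  by apply/set0Pn; rewrite -card_gt0 ltnW.
have pSN R : R \in 'Syl_p(N) -> p.-group R /\ R \subset N.
  by rewrite inE => /and3P[? ? _].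
rewrite [X in _ < X](cardsD1 D) !inE ntD.
have [pR0 sR0N] := pSN _ SR0; have sDR0 := proper_sub (prD _ SR0).
rewrite (pgroupS sDR0 pR0) (subset_trans sDR0 sR0N) ltnS.
apply/subset_leq_card/subsetP=> _ /imsetP[[R A] /[1!in_set] /andP[/= SR UA] ->] /=.
have [pR sRN] := pSN _ SR; have sAR := sUR _ _ UA.
have nAD := notUD _ _ SR UA; rewrite !inE.
rewrite (pgroupS sAR pR) (subset_trans sAR sRN) andbT /=.
apply/andP; split; first by apply: contra nAD => /eqP->.
by apply: contra nAD => /eqP->; apply: sub1G.
Qed.

(** The number k of Sylow subgroups exceeds 1 and is 1 mod p, so k (p + 1) is at least 15 unless p =
    2 and k = 3. In that case there are at least 10 non-trivial 2-subgroups, and five subgroups of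
    other orders are needed. *)
Lemma card_nontrivial_subgroups_TI (gT : finGroupType) (p : nat)
    (N D : {group gT}) :
    prime p -> D :!=: 1 -> 1 < #|'Syl_p(N)| ->
    {in 'Syl_p(N), forall R : {group gT}, ~~ cyclic R} ->
    (forall R1 R2 : {group gT}, R1 \in 'Syl_p(N) -> R2 \in 'Syl_p(N) ->
       R1 != R2 -> R1 :&: R2 = D) ->
  14 < #|nontrivial_subgroups N|.
Proof.
move=> p_pr ntD gtS1 ncS tiS.
have ltS := card_psubgroups_TI p_pr ntD gtS1 ncS tiS.
set F := [set H in _ | _] in ltS; pose F' := nontrivial_subgroups N :\: F.
have cardN : #|nontrivial_subgroups N| = #|F| + #|F'|.
  have sF : F \subset nontrivial_subgroups N.
    by apply/subsetP=> H /[1!in_set] /andP[].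
  by rewrite -(cardsID F) (setIidPr sF).
rewrite cardN; have := card_Syl_mod N p_pr; set k := #|_| in gtS1 ltS * => modk.
have [p2 | p_neq2] := eqVneq p 2; last first.
  have p_gt2 : 2 < p by rewrite ltn_neqAle eq_sym p_neq2 prime_gt1.
  have gtkp : p < k.
    by rewrite ltnNge leq_eqVlt; apply/negP => /orP[/eqP e | /modn_small e];
       move: modk gtS1; rewrite e ?modnn // => ->.
  have : 4 * 4 <= k * p.+1 by rewrite leq_mul // (leq_ltn_trans _ gtkp).
  by lia.
have [k_le3 | k_gt3] := leqP k 3; last first.
  have : 4 < k.
    by rewrite ltn_neqAle k_gt3 andbT; apply/eqP=> k4; rewrite -k4 p2 in modk.
  by move: ltS; rewrite p2; lia.
have k3 : k = 3.
  by move: gtS1 k_le3 modk; rewrite p2; case: k ltS => [|[|[|[|]]]].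
(* The dihedral group of order 12 attains the bound in this last case, where
   the missing subgroups are those of order divisible by 3. *)
rewrite k3 p2 in ltS; suff : 4 < #|F'| by lia.
have [R SR] : exists R, R \in 'Syl_p(N).
  by apply/set0Pn; rewrite -card_gt0 ltnW.
have sylR : p.-Sylow(N) R by rewrite inE in SR.
have [sRN pR _] := and3P sylR.
have ncR := ncS R SR.
have ntR : R :!=: 1 by apply: contraNneq ncR => ->; apply: cyclic1.
have dv3N : 3 %| #|N| by rewrite -k3 /k card_Syl_dvd.
have inF' (H : {group gT}) : H \subset N -> 3 %| #|H| -> H \in F'.
  move=> sHN dv3H; have ntH : H :!=: 1.
    by apply: contraTneq dv3H => ->; rewrite cards1.
  rewrite !inE sHN ntH /= andbT p2.
  by apply/negP=> /pgroupP/(_ 3 isT dv3H).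
have [Q sylQ] := Sylow_exists 3 N; have [sQN q3Q _] := and3P sylQ.
have dv3Q : 3 %| #|Q|.
  rewrite (card_Hall sylQ) p_part dvdn_exp // logn_gt0 mem_primes /=.
  by rewrite cardG_gt0.
(* If there are several Sylow 3-subgroups there are at least four, and [N] itself is the fifth
   subgroup. *)
have [n3 | gt1n3] := leqP #|'Syl_3(N)| 1; last first.
  have mod3 := card_Syl_mod N (isT : prime 3).
  have gt3n3 : 3 < #|'Syl_3(N)|.
    by move: gt1n3 mod3; case: #|_| => [|[|[|[|]]]].
  have NnS : N \notin 'Syl_3(N).
    rewrite inE; apply/negP => /pHall_pgroup q3N.
    have [_ dv2R _] := pgroup_pdiv pR ntR.
    move/pgroupP: q3N => /(_ p p_pr (dvdn_trans dv2R (cardSg sRN))).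
    by rewrite p2.
  apply: (@leq_trans #|N |: 'Syl_3(N)|); first by rewrite cardsU1 NnS.
  apply/subset_leq_card/subsetP=> H /[1!in_setU1] /orP[/eqP-> | /[1!inE] sylH].
    exact: inF'.
  have [sHN _ _] := and3P sylH; apply: inF' => //.
  by rewrite (card_Hall sylH) -(card_Hall sylQ).
(* When Q is normal, these are the products Q A with A trivial, maximal in R,
   or equal to R. *)
have nQN : Q <| N.
  have /normal_sylowP[Q' sylQ' nQ'] : #|'Syl_3(N)| == 1%N.
    by rewrite eqn_leq n3 card_gt0; apply/set0Pn; exists Q; rewrite inE.
  have [x Nx ->] := Sylow_trans sylQ' sylQ.
  by rewrite (normP (subsetP (normal_norm nQ') x Nx)).
have tiQR : Q :&: R = 1.
  apply: coprime_TIg; apply: pnat_coprime q3Q _.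
  by apply: sub_pgroup pR => q /[!inE] /eqP->; rewrite p2.
pose W : {set {group gT}} := R |: (1%G |: [set A : {group gT} | maximal A R]).
have cardW : 4 < #|W|.
  have := card_maximal_noncyclic pR ncR.
  rewrite p2 !cardsU1 !inE.
  have -> : maximal R R = false.
    by apply/negP=> /maxgroupp/proper_subn; rewrite subxx.
  have -> : maximal 1 R = false.
    apply/negP=> max1; case/negP: ncR; apply: prime_cyclic.
    by have := p_maximal_index pR max1; rewrite indexg1 => ->.
  by rewrite -val_eqE /= (negPf ntR).
have sWR (A : {group gT}) : A \in W -> A \subset R.
  rewrite !inE => /or3P[/eqP-> // | /eqP-> | /maxgroupp/proper_sub //].
  exact: sub1G.
pose f (A : {group gT}) := (Q <*> A)%G.
have injf : {in W &, injective f}.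
  (* By the modular law, A is recovered from Q A by intersecting with R. *)
  have fK (A : {group gT}) : A \in W -> Q <*> A :&: R = A.
    move=> WA; have sAR := sWR A WA; rewrite norm_joinEr; last first.
      exact: subset_trans sAR (subset_trans sRN (normal_norm nQN)).
    by rewrite setIC -group_modr // setIC tiQR mul1g.
  move=> A B WA WB /(congr1 val) /= eqf; apply: val_inj => /=.
  by rewrite -(fK A WA) eqf fK.
apply: leq_trans cardW _; rewrite -(card_in_imset injf).
apply/subset_leq_card/subsetP=> _ /imsetP[A WA ->]; apply: inF' => /=.
  by rewrite join_subG sQN (subset_trans (sWR A WA)).
by rewrite (dvdn_trans dv3Q) // cardSg ?joing_subl.
Qed.

(** Otherwise the normalizer of a largest Sylow intersection would have several non-cyclic Sylow
    p-subgroups, pairwise meeting in that intersection, and so too many subgroups by the previous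
    count. *)
Lemma Sylow_TI (gT : finGroupType) (p : nat) (G P : {group gT}) :
    prime p -> p.-Sylow(G) P -> ~~ cyclic P ->
    (forall D : {group gT}, D \subset G -> p.-group D -> D :!=: 1 ->
       #|nontrivial_subgroups 'N_G(D)| <= 14) ->
  forall P1 P2 : {group gT}, P1 \in 'Syl_p(G) -> P2 \in 'Syl_p(G) ->
    P1 != P2 -> P1 :&: P2 = 1.
Proof.
move=> p_pr sylP ncP smallN Q1 Q2 SQ1 SQ2 neQ; apply/eqP/negPn/negP=> ntQ.
pose T (u : {group gT} * {group gT}) :=
  [&& u.1 \in 'Syl_p(G), u.2 \in 'Syl_p(G) & u.1 != u.2].
have TQ : T (Q1, Q2) by apply/and3P.
(* D is an intersection of two Sylow subgroups of maximal order, so two Sylow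
   subgroups of its normalizer N always meet in D. *)
case: (@arg_maxnP _ (Q1, Q2) T (fun u => #|u.1 :&: u.2|) TQ) => -[P1 P2].
case/and3P=> /= SP1 SP2 neP maxP; pose D := (P1 :&: P2)%G.
have leD P3 P4 : P3 \in 'Syl_p(G) -> P4 \in 'Syl_p(G) -> P3 != P4 ->
    #|P3 :&: P4| <= #|D|.
  by move=> SP3 SP4 neP34; apply: (maxP (P3, P4)); apply/and3P.
have ntD : D :!=: 1.
  by rewrite -cardG_gt1 (leq_trans _ (leD _ _ SQ1 SQ2 neQ)) // cardG_gt1.
have [sylP1 sylP2] : p.-Sylow(G) P1 /\ p.-Sylow(G) P2.
  by move: SP1 SP2; rewrite !inE.
have [[sP1G pP1 _] [sP2G pP2 _]] := (and3P sylP1, and3P sylP2).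
have sDG : D \subset G by rewrite subIset ?sP1G.
have pD : p.-group D by apply: pgroupS pP1; apply: subsetIl.
pose N := 'N_G(D)%G.
have nsDN : D <| N by apply: normalSG.
have sNG : N \subset G by apply: subsetIl.
have ltD (P3 : {group gT}) : p.-group P3 -> D \proper P3 -> D \proper 'N_P3(D).
  by move=> pP3; apply: nilpotent_proper_norm; apply: pgroup_nil pP3.
have prD1 : D \proper P1.
  rewrite properE subsetIl subsetI subxx /=; apply: contra neP => sP12.
  by rewrite -val_eqE eqEcard sP12 /= (card_Hall sylP1) (card_Hall sylP2).
have prD2 : D \proper P2.
  rewrite properE subsetIr subsetI subxx andbT /=; apply: contra neP => sP21.
  by rewrite eq_sym -val_eqE eqEcard sP21 /= (card_Hall sylP1) (card_Hall sylP2).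
have sDR (R : {group gT}) : R \in 'Syl_p(N) -> D \subset R.
  rewrite inE => sylR; apply: subset_trans (pcore_sub_Hall sylR).
  exact: pcore_max.
have supR (R : {group gT}) : R \in 'Syl_p(N) ->
    exists2 P3 : {group gT}, P3 \in 'Syl_p(G) & R = (P3 :&: N)%G.
  rewrite inE => sylR; have [sRN pR _] := and3P sylR.
  have [P3 sylP3 sRP3] := Sylow_superset (subset_trans sRN sNG) pR.
  exists P3; rewrite ?inE //; apply/val_inj/esym/(sub_pHall sylR) => /=.
  - by apply: pgroupS (pHall_pgroup sylP3); apply: subsetIl.
  - by rewrite subsetI sRP3.
  - exact: subsetIr.
(* Normalizers grow in p-groups: if N had a single Sylow p-subgroup, contained in P3, then P1 and P2
   would each meet P3 in more than D, and maximality would give P1 = P3 = P2. *)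
have gt1 : 1 < #|'Syl_p(N)|.
  rewrite ltnNge; apply/negP=> le1.
  have supN (P3 : {group gT}) : P3 \in 'Syl_p(G) -> D \proper P3 ->
      exists2 R, R \in 'Syl_p(N) & 'N_P3(D) \subset R.
    rewrite inE => sylP3 prD3; have [sP3G pP3 _] := and3P sylP3.
    have pN3 : p.-group 'N_P3(D) by apply: pgroupS pP3; apply: subsetIl.
    have [R sylR sN3R] := Sylow_superset (setSI _ sP3G : _ \subset N) pN3.
    by exists R; rewrite ?inE.
  have [[R1 SR1 sR1] [R2 SR2 sR2]] := (supN _ SP1 prD1, supN _ SP2 prD2).
  have [P3 SP3 eR1] := supR _ SR1.
  have eR12 : R1 = R2 by apply: (card_le1_eqP le1).
  have eqP3 (P4 : {group gT}) : P4 \in 'Syl_p(G) -> D \proper P4 ->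
      'N_P4(D) \subset R1 -> P4 = P3.
    move=> SP4 prD4 sR; apply/eqP/negPn/negP => ne43.
    have := leD _ _ SP4 SP3 ne43; rewrite leqNgt => /negP[].
    have pP4 : p.-group P4 by move: SP4; rewrite inE => /pHall_pgroup.
    apply: leq_trans (proper_card (ltD _ pP4 prD4)) (subset_leq_card _).
    by rewrite subsetI subsetIl (subset_trans sR) // eR1 /= subsetIl.
  rewrite -eR12 in sR2.
  by case/eqP: neP; rewrite (eqP3 P1 SP1 prD1 sR1) (eqP3 P2 SP2 prD2 sR2).
(* If R is cyclic then D is characteristic in R, so R is its own normalizer in
   P3, whence R = P3. *)
have ncR : {in 'Syl_p(N), forall R : {group gT}, ~~ cyclic R}.
  move=> R SR; have [P3 SP3 eR] := supR R SR.
  apply/negP=> cycR; case/negP: ncP.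
  have sylP3 : p.-Sylow(G) P3 by rewrite inE in SP3.
  have [sP3G pP3 _] := and3P sylP3.
  have [x _ ->] := Sylow_trans sylP3 sylP; rewrite cyclicJ.
  suff -> : P3 :=: R by [].
  apply: (nilpotent_sub_norm (pgroup_nil pP3)).
    by rewrite eR subsetIl.
  have chD : D \char R by rewrite sub_cyclic_char ?sDR.
  rewrite {2}eR /= !subsetI subsetIl (subset_trans (subsetIl _ _) sP3G).
  by rewrite (subset_trans (subsetIr _ _)) ?char_norms.
suff tiN (R1 R2 : {group gT}) : R1 \in 'Syl_p(N) -> R2 \in 'Syl_p(N) ->
    R1 != R2 -> R1 :&: R2 = D.
  have := card_nontrivial_subgroups_TI p_pr ntD gt1 ncR tiN.
  by rewrite ltnNge smallN.
move=> SR1 SR2 neR.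
have [[P3 SP3 eR1] [P4 SP4 eR2]] := (supR R1 SR1, supR R2 SR2).
have ne34 : P3 != P4 by apply: contra neR => /eqP e; rewrite eR1 eR2 e.
apply/esym/eqP; rewrite eqEcard subsetI !sDR //=.
apply: leq_trans (leD _ _ SP3 SP4 ne34); rewrite subset_leq_card //.
by rewrite setISS // ?eR1 ?eR2 subsetIl.
Qed.

(** The subgroups of order p cover V and meet trivially, so there are at least p^2 + p + 1 >= 13 of
    them; a subgroup of order p^2 and V itself bring the total to 15. *)
Lemma card_nontrivial_subgroups_abelem (gT : finGroupType) (p : nat)
    (V : {group gT}) :
    p.-abelem V -> 2 < p -> p ^ 2 < #|V| -> 14 < #|nontrivial_subgroups V|.
Proof.
move=> abV p_gt2 ltV; have pV := abelem_pgroup abV.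
have ntV : V :!=: 1.
  by rewrite -cardG_gt1 (leq_trans _ ltV) // ltnS expn_gt0 (ltnW (ltnW p_gt2)).
have [p_pr _ _] := pgroup_pdiv pV ntV.
have [r cardV] := p_natP pV.
have r_gt2 : 2 < r by rewrite -(ltn_exp2l _ _ (prime_gt1 p_pr)) -cardV.
pose S1 := [set A in nontrivial_subgroups V | #|A| == p].
have cover : V^# \subset \bigcup_(A in S1) A^#.
  apply/subsetP=> x /setD1P[nt_x Vx]; apply/bigcupP; exists <[x]>%G.
    by rewrite !inE cycle_subG Vx cycle_eq1 nt_x -orderE (abelem_order_p abV) /=.
  by rewrite !inE nt_x cycle_id.
have leV : #|V^#| <= #|S1| * p.-1.
  apply: leq_trans (subset_leq_card cover) _; rewrite -sum_nat_const.
  apply: (@leq_trans (\sum_(A in S1) #|A^#|)).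
    elim/big_rec2: _ => [|A n B _ IH]; first by rewrite cards0.
    by apply: leq_trans (leq_card_setU _ _) _; rewrite leq_add2l.
  apply: leq_sum => A; rewrite in_set => /andP[_ /eqP<-].
  by rewrite (cardsD1 1 A) group1.
have lt12 : 12 < #|S1|.
  rewrite -(ltn_pmul2r (m := p.-1)) ?(leq_trans _ leV) //; last by lia.
  have : p ^ 3 <= #|V| by rewrite cardV leq_exp2l ?prime_gt1.
  rewrite (cardsD1 1 V) group1 !expnS expn0; move: #|_|; nia.
have [Q [sQV _ oQ]] : exists Q : {group gT}, [/\ Q \subset V, Q <| V & #|Q| = (p ^ 2)%N].
  by apply: normal_pgroup => //; rewrite cardV pfactorK // ltnW.
have ltp2 : p < p ^ 2 by rewrite -{1}(expn1 p) ltn_exp2l ?prime_gt1.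
have QnS : Q \notin S1 by rewrite !inE oQ (gtn_eqF ltp2) andbF.
have VnS : V \notin Q |: S1.
  rewrite !inE (gtn_eqF (ltn_trans ltp2 ltV)) andbF orbF.
  by apply: contraTneq ltV => ->; rewrite oQ ltnn.
apply: (@leq_trans #|V |: (Q |: S1)|); first by rewrite !cardsU1 QnS VnS.
apply/subset_leq_card/subsetP=> H.
rewrite in_setU1 in_setU1 => /or3P[/eqP-> | /eqP-> | /[1!in_set] /andP[] //].
  by rewrite in_set subxx.
by rewrite in_set sQV -cardG_gt1 oQ -[1%N]/(p ^ 0)%N ltn_exp2l ?prime_gt1.
Qed.

(** * Frattini quotients and control of fusion *)

(* |P / Phi(P)| and the order of the fixed points of Q differ by a multiple of
   q, while q > p divides neither p - 1 nor, for p odd, p^2 - 1. *)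
Lemma coprime_pgroup_cent (gT : finGroupType) (p q : nat) (P Q : {group gT}) :
    prime p -> prime q -> p < q -> p.-group P -> q.-group Q -> Q \subset 'N(P) ->
    (#|P / 'Phi(P)| <= p) || odd p && (#|P / 'Phi(P)| <= p ^ 2) ->
  Q \subset 'C(P).
Proof.
move=> p_pr q_pr ltpq pP qQ nPQ leV; set V := (P / 'Phi(P))%G in leV.
have nFQ : Q \subset 'N('Phi(P)) by apply: gFnorm_trans.
have pV : p.-group V by apply: quotient_pgroup.
have coPQ : coprime #|P| #|Q|.
  apply: (pnat_coprime pP); apply: sub_pgroup qQ => r /[!inE] /eqP->.
  by rewrite (gtn_eqF ltpq).
have nVQ : Q / 'Phi(P) \subset 'N(V) by apply: quotient_norms.
have defC : 'C_V(Q / 'Phi(P)) = V.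
  have := pgroup_fix_mod (quotient_pgroup 'Phi(P) qQ)
            (_ : [acts Q / 'Phi(P), on V | 'J]).
  rewrite astabsJ afixJ => /(_ nVQ) /eqP.
  have pC : p.-group 'C_V(Q / 'Phi(P)) by apply: pgroupS pV; apply: subsetIl.
  have [r oV] := p_natP pV; have [i oC] := p_natP pC.
  have le_ir : i <= r.
    by rewrite -(leq_exp2l _ _ (prime_gt1 p_pr)) -oV -oC subset_leq_card ?subsetIl.
  have p_gt1 := prime_gt1 p_pr.
  have coqp : coprime q (p ^ i).
    by rewrite coprimeXr // prime_coprime // gtnNdvd ?prime_gt0.
  rewrite oV oC eqn_mod_dvd ?leq_exp2l // -(subnKC le_ir) expnD -{2}[(p ^ i)%N]muln1.
  rewrite -mulnBr Gauss_dvdr // => dvq.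
  apply/eqP; rewrite eqEcard subsetIl oC /= oV leq_exp2l //.
  rewrite -subn_eq0 -leqn0 leqNgt; apply/negP => gt0.
  have r_le : (r <= 1) || odd p && (r <= 2).
    by move: leV; rewrite oV -{2}(expn1 p) !leq_exp2l.
  (* Now q divides p^(r - i) - 1 with r - i equal to 1 or 2; in the second case p is odd and q would
     have to be p + 1, which is even. *)
  have [e1 | ne1] := eqVneq (r - i) 1%N.
    move: dvq; rewrite e1 expn1 gtnNdvd ?subn_gt0 //.
    exact: leq_ltn_trans (leq_subr _ _) ltpq.
  have /andP[oddp r_le2] : odd p && (r <= 2).
    case/orP: r_le => // r_le1; case/eqP: ne1; apply/eqP.
    by rewrite eqn_leq gt0 (leq_trans (leq_subr _ _)).
  have e2 : r - i = 2%N.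
    apply/eqP; rewrite eqn_leq (leq_trans (leq_subr _ _)) //=.
    by rewrite ltn_neqAle eq_sym ne1.
  move: dvq; rewrite e2 -[1%N]/(1 ^ 2)%N subn_sqr Euclid_dvdM //.
  rewrite gtnNdvd ?subn_gt0 ?(leq_ltn_trans (leq_subr _ _) ltpq) //=.
  rewrite addn1 => /(dvdn_leq (ltn0Sn p)) leqS.
  have eq1 : q = p.+1 by apply/eqP; rewrite eqn_leq leqS.
  have [q2|] := even_prime q_pr; last by rewrite eq1 /= oddp.
  by move: ltpq; rewrite q2 ltnNge p_gt1.
have : 'C_P(Q) / 'Phi(P) = V.
  by rewrite coprime_quotient_cent ?Phi_sub ?(pgroup_sol pP).
move=> defV; rewrite centsC; apply/setIidPl.
have nFC : 'C_P(Q) \subset 'N('Phi(P)) by rewrite subIset ?gFnorm.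
rewrite -[LHS]genGid; apply: Phi_nongen.
by rewrite norm_joinEr // -quotientK // defV quotientGK ?Phi_normal.
Qed.

(** The normalizer is generated by its own Sylow subgroups: those for p lie in P, and those for
    larger primes centralize P. *)
Lemma norm_Sylow_sub_cent (gT : finGroupType) (p : nat) (G P : {group gT}) :
    prime p -> p.-Sylow(G) P ->
    (forall q, prime q -> q %| #|G| -> p <= q) ->
    (#|P / 'Phi(P)| <= p) || odd p && (#|P / 'Phi(P)| <= p ^ 2) ->
  'N_G(P) \subset P * 'C(P).
Proof.
move=> p_pr sylP minp leV; have [sPG pP _] := and3P sylP.
rewrite -cent_joinEr ?subxx // -(Sylow_gen 'N_G(P)) gen_subG.
apply/bigcupsP=> Q /SylowP[q q_pr sylQ]; have [sQN qQ _] := and3P sylQ.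
have nPQ : Q \subset 'N(P) by apply: subset_trans sQN (subsetIr _ _).
have [-> | ntQ] := eqsVneq Q 1; first exact: sub1G.
have [_ dvQ _] := pgroup_pdiv qQ ntQ.
have : p <= q.
  by rewrite minp // (dvdn_trans dvQ) // cardSg // (subset_trans sQN) ?subsetIl.
rewrite leq_eqVlt => /orP[/eqP eqpq | ltpq]; last first.
  apply: subset_trans (joing_subr _ _).
  exact: coprime_pgroup_cent ltpq pP qQ nPQ leV.
apply: subset_trans (joing_subl _ _); rewrite -eqpq in qQ.
have sylPN : p.-Sylow('N_G(P)) P by rewrite Sylow_subnorm.
by rewrite (sub_normal_Hall sylPN) ?normalSG.
Qed.

(** Burnside's argument: both P and its conjugate by g are Sylow subgroups of the centralizer of
    [x ^ g], so some c in that centralizer takes the conjugate back to P, and g c normalizes P. *)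
Lemma abelian_Sylow_fusion (gT : finGroupType) (p : nat) (G P : {group gT}) :
    p.-Sylow(G) P -> abelian P ->
  forall x g, x \in P -> g \in G -> x ^ g \in P ->
    exists2 n, n \in 'N_G(P) & x ^ g = x ^ n.
Proof.
move=> sylP abP x g Px Gg Pxg; have [sPG _ _] := and3P sylP.
pose C := 'C_G[x ^ g]%G.
have sylC (Q : {group gT}) : Q \subset C -> p.-Sylow(G) Q -> p.-Sylow(C) Q.
  by move=> sQC; apply: pHall_subl => //; apply: subsetIl.
have sPC : P \subset C.
  by rewrite subsetI sPG sub_cent1 (subsetP abP).
have sPgC : P :^ g \subset C.
  rewrite subsetI -{1}(conjGid Gg) conjSg sPG sub_cent1.
  by rewrite centJ memJ_conjg (subsetP abP).
have sylPg : p.-Sylow(G) (P :^ g)%G by rewrite pHallJ.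
have [c Cc defP] := Sylow_trans (sylC _ sPgC sylPg) (sylC P sPC sylP).
have [Gc /cent1P cxc] := setIP Cc.
exists (g * c); last by rewrite conjgM [_ ^ c]conjgE -cxc mulKg.
by rewrite inE groupM //= inE conjsgM -defP.
Qed.

(** Fusion in P is induced by elements u c with u in P and c centralizing P, and conjugation by u is
    trivial modulo P', so [transfer_control] applies. *)
Lemma Sylow_der1_trivg (gT : finGroupType) (p : nat) (G P : {group gT}) :
    prime p -> p.-Sylow(G) P ->
    (forall q, prime q -> q %| #|G| -> p <= q) ->
    (#|P / 'Phi(P)| <= p) || odd p && (#|P / 'Phi(P)| <= p ^ 2) ->
    (forall x g, x \in P -> g \in G -> x ^ g \in P ->
       exists2 n, n \in 'N_G(P) & x ^ g = x ^ n) ->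
  P \subset G^`(1) -> P :=: 1.
Proof.
move=> p_pr sylP minp leV fusP; apply: (transfer_control sylP) => x g Px Gg Pxg.
have [n Nn ->] := fusP x g Px Gg Pxg.
have /mulsgP[u c Pu Cc ->] := subsetP (norm_Sylow_sub_cent p_pr sylP minp leV) n Nn.
have nP' y : y \in P -> y \in 'N(P^`(1)) by apply/subsetP/der_norm.
rewrite conjgM [_ ^ c]conjgE -(centP Cc (x ^ u)) ?groupJ // mulKg.
rewrite morphJ ?nP' // conjgE.
have /centsP abP := der_abelian 0 P.
by rewrite (abP _ _ (coset P^`(1) u)) ?mem_quotient // mulKg.
Qed.

(** * Sylow subgroups with trivial intersections, and the case p = 2 *)

Lemma TI_Sylow_norm_trivg (gT : finGroupType) (p : nat) (G P Q : {group gT}) :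
    (forall P1 P2 : {group gT}, P1 \in 'Syl_p(G) -> P2 \in 'Syl_p(G) ->
       P1 != P2 -> P1 :&: P2 = 1) ->
    P \in 'Syl_p(G) -> Q \in 'Syl_p(G) -> P != Q -> 'N_P(Q) = 1.
Proof.
move=> tiS SP SQ nePQ; apply/trivgP/subsetP=> x /setIP[Px nQx].
rewrite -(tiS P Q) // inE Px.
move: SP SQ; rewrite !inE => sylP sylQ.
(* A normal Sylow subgroup of ['N_G(Q)] contains all its p-elements. *)
have sylQN : p.-Sylow('N_G(Q)) Q by rewrite Sylow_subnorm.
have [sPG pP _] := and3P sylP; have [sQG _ _] := and3P sylQ.
rewrite (mem_normal_Hall sylQN) ?normalSG ?(mem_p_elt pP) //.
by rewrite inE nQx (subsetP sPG).
Qed.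

Lemma TI_Sylow_orbit (gT : finGroupType) (p : nat) (G P Q : {group gT}) :
    (forall P1 P2 : {group gT}, P1 \in 'Syl_p(G) -> P2 \in 'Syl_p(G) ->
       P1 != P2 -> P1 :&: P2 = 1) ->
    P \in 'Syl_p(G) -> Q \in 'Syl_p(G) -> P != Q ->
  #|orbit 'JG P Q| = #|P|.
Proof.
move=> tiS SP SQ nePQ.
by rewrite card_orbit astab1JG (TI_Sylow_norm_trivg tiS SP SQ nePQ) indexg1.
Qed.

Lemma norm_Sylow_acts (gT : finGroupType) (p : nat) (G P : {group gT}) :
  P \in 'Syl_p(G) -> [acts 'N_G(P), on 'Syl_p(G) :\ P | 'JG].
Proof.
rewrite inE => sylP; have [sPG _ _] := and3P sylP.
apply/actsP=> x /setIP[Gx nPx] Q; rewrite !inE /= pHallJ //.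
congr (~~ _ && _); rewrite -!val_eqE /= -{1}(normP nPx).
exact: (inj_eq (@conjsg_inj _ x)).
Qed.

Lemma Sylow_acts (gT : finGroupType) (p : nat) (G P : {group gT}) :
  P \in 'Syl_p(G) -> [acts P, on 'Syl_p(G) :\ P | 'JG].
Proof.
move=> SP; apply: subset_trans (norm_Sylow_acts SP).
by move: SP; rewrite inE subsetI normG andbT => /pHall_sub.
Qed.

(** P permutes the other Sylow subgroups by conjugation, in orbits of length |P|. *)
Lemma card_TI_Sylow (gT : finGroupType) (p : nat) (G P : {group gT}) :
    (forall P1 P2 : {group gT}, P1 \in 'Syl_p(G) -> P2 \in 'Syl_p(G) ->
       P1 != P2 -> P1 :&: P2 = 1) ->
    P \in 'Syl_p(G) -> exists m, #|'Syl_p(G)| = (m * #|P|).+1.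
Proof.
move=> tiS SP; have := orbit_partition (Sylow_acts SP).
set pi := [set _ | _ in _] => part_pi; exists #|pi|.
rewrite (cardsD1 P) SP (@card_uniform_partition _ #|P| _ _ _ part_pi) //.
move=> _ /imsetP[Q /setD1P[neQP SQ] ->].
by rewrite (TI_Sylow_orbit tiS) 1?eq_sym.
Qed.

Lemma card_involutionsJ (gT : finGroupType) (P : {group gT}) x :
  #|involutions (P :^ x)| = #|involutions P|.
Proof.
suff -> : involutions (P :^ x) = involutions P :^ x by rewrite cardJg.
by apply/setP=> y; rewrite mem_conjg !inE mem_conjg orderJ.
Qed.

Lemma card_involutions_TI (gT : finGroupType) (G P : {group gT}) :
    (forall P1 P2 : {group gT}, P1 \in 'Syl_2(G) -> P2 \in 'Syl_2(G) ->
       P1 != P2 -> P1 :&: P2 = 1) ->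
    P \in 'Syl_2(G) ->
  #|'Syl_2(G)| * #|involutions P| <= #|involutions G|.
Proof.
move=> tiS SP.
pose S := [set u : {group gT} * gT |
            (u.1 \in 'Syl_2(G)) && (u.2 \in involutions u.1)].
have -> : (#|'Syl_2(G)| * #|involutions P| = #|S|)%N.
  have -> : #|S| = \sum_(R in 'Syl_2(G)) \sum_(x in involutions R) 1.
    by rewrite pair_big_dep /= -sum1_card; apply: eq_bigl => u; rewrite !inE.
  rewrite -sum_nat_const; apply: eq_bigr => R SR; rewrite sum1_card.
  move: SP SR; rewrite !inE => sylP sylR.
  by have [x _ ->] := Sylow_trans sylP sylR; rewrite card_involutionsJ.
have injS : {in S &, injective snd}.
  move=> [R1 x] [R2 y] /[!inE] /= /and3P[SR1 R1x ox] /and3P[SR2 R2y _] exy.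
  rewrite -{}exy in R2y *; congr (_, _); apply/eqP/negPn/negP => neR.
  have x1 : x = 1 by apply/set1gP; rewrite -(tiS R1 R2) ?in_setI ?R1x // inE.
  by rewrite x1 order1 in ox.
rewrite -(card_in_imset injS).
apply/subset_leq_card/subsetP=> _ /imsetP[[R x] /[!inE] /= /and3P[SR Rx ox] ->].
have [sRG _ _] := and3P SR.
by rewrite (subsetP sRG).
Qed.

Lemma TI_Sylow2_involutions (gT : finGroupType) (G P : {group gT}) :
    simple G -> ~~ solvable G -> P \in 'Syl_2(G) -> ~~ cyclic P ->
    (forall P1 P2 : {group gT}, P1 \in 'Syl_2(G) -> P2 \in 'Syl_2(G) ->
       P1 != P2 -> P1 :&: P2 = 1) ->
  14 < #|involutions G|.
Proof.
move=> simG nsolG SP ncP tiS; have leI := card_involutions_TI tiS SP.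
have [m cardS] := card_TI_Sylow tiS SP.
have sylP : 2.-Sylow(G) P by rewrite inE in SP.
have [sPG pP _] := and3P sylP.
have ntP : P :!=: 1 by apply: contraNneq ncP => ->; apply: cyclic1.
have [_ simG'] := simpleP _ simG.
have nnP : ~~ (G \subset 'N(P)).
  apply/negP=> nPG; case: (simG' P) => [|P1|PG]; first by rewrite /normal sPG.
    by rewrite P1 eqxx in ntP.
  by case/negP: nsolG; rewrite -PG (pgroup_sol pP).
have m_gt0 : 0 < m.
  rewrite lt0n; apply: contraNneq nnP => m0.
  have /normal_sylowP[Q sylQ /andP[_ nQG]] : #|'Syl_2(G)| == 1%N by rewrite cardS m0.
  have [x Gx ->] := Sylow_trans sylQ sylP.
  by rewrite (normP (subsetP nQG x Gx)).
have [_ dv2 [n oP]] := pgroup_pdiv pP ntP.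
have [t Pt ot] := Cauchy (isT : prime 2) dv2.
have I_gt0 : 0 < #|involutions P|.
  by apply/card_gt0P; exists t; rewrite inE Pt ot.
rewrite ltnNge; apply/negP=> leI14.
have leP : #|P|.+1 * #|involutions P| <= 14.
  apply: leq_trans leI14; apply: leq_trans leI.
  by rewrite leq_mul2r cardS ltnS leq_pmull ?orbT.
(* The exponent is shifted: |P| = 2^(n + 1), so n = 0 would make P cyclic. *)
have n_gt0 : 0 < n.
  by rewrite lt0n; apply: contraNneq ncP => n0; rewrite prime_cyclic // oP n0.
have n_le2 : n <= 2.
  rewrite leqNgt; apply/negP=> n_gt2.
  have leP16 : 2 ^ 4 <= #|P| by rewrite oP leq_exp2l.
  by have := leq_trans (leq_mul (leq_ltn_trans leP16 (ltnSn _)) I_gt0) leP.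
have [n1 | n2] : n = 1%N \/ n = 2%N.
  by case: (n) n_gt0 n_le2 => [|[|[|k]]] // _ _; [left | right].
  have I3 : 3 <= #|involutions P|.
    suff -> : involutions P = P^#.
      by have /eqP := oP; rewrite n1 (cardsD1 1 P) group1 add1n eqSS => /eqP->.
    apply/setP=> x; rewrite !inE andbC; apply: andb_id2r => Px.
    have := order_dvdG Px; rewrite oP n1 -order_eq1.
    case/dvdn_pfactor=> // -[|[|[|//]]] _ ox; rewrite ox //.
    case/negP: ncP; apply/cyclicP; exists x; apply/esym/eqP.
    by rewrite eqEcard cycle_subG Px oP n1 -orderE ox.
  by have := leq_trans (leq_mul (leqnn _) I3) leP; rewrite oP n1.
(* With |P| = 8, already m = 2 would give 17 Sylow subgroups, each with an involution of its own. *)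
have m1 : m = 1%N.
  have := leq_trans (leq_pmulr _ I_gt0) (leq_trans leI leI14).
  by rewrite cardS oP n2; move: m_gt0; case: (m) => [|[|k]].
rewrite m1 mul1n oP n2 in cardS.
have uniqI : #|involutions P| = 1%N.
  apply/eqP; rewrite eqn_leq I_gt0 andbT leqNgt; apply/negP=> I_gt1.
  have := leq_trans (leq_mul (leqnn _) I_gt1) (leq_trans leI leI14).
  by rewrite cardS.
have cardS8 : #|'Syl_2(G) :\ P| = 8.
  by have /eqP := cardS; rewrite (cardsD1 P) SP add1n eqSS => /eqP.
have orbS Q : Q \in 'Syl_2(G) -> Q != P -> orbit 'JG P Q = 'Syl_2(G) :\ P.
  move=> SQ neQP; apply/eqP; rewrite eqEcard (TI_Sylow_orbit tiS) 1?eq_sym //.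
  by rewrite oP n2 cardS8 leqnn andbT acts_sub_orbit ?Sylow_acts // in_setD1 neQP.
(* The remaining case |P| = 8: an element y of order q > 3 normalizing P fixes
   the only involution of P, hence centralizes P; it also normalizes one of the
   eight other Sylow 2-subgroups, hence all of them as P permutes these
   transitively. *)
have [q q_pr [q_gt3 dvqG]] : exists2 q, prime q & 3 < q /\ q %| #|G|.
  have [/hasP[q]|/hasPn no_q] := boolP (has (ltn 3) (primes #|G|)).
    by rewrite mem_primes => /and3P[q_pr _ dvq] q_gt3; exists q.
  case/negP: nsolG; apply: Burnside_p_a_q_b.
  apply: (@uniq_leq_size _ _ [:: 2; 3]) (primes_uniq _) _ => q pi_q.
  have := no_q q pi_q; move: pi_q; rewrite mem_primes => /andP[q_pr _].
  by case: q q_pr => [|[|[|[|]]]].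
have dvqN : q %| #|'N_G(P)|.
  have := Lagrange (subsetIl G 'N(P)); rewrite -(card_Syl sylP) cardS => oG.
  move: dvqG; rewrite -oG Euclid_dvdM // => /orP[//|].
  by rewrite dvdn_divisors // !inE => /or3P[] /eqP q_eq; rewrite q_eq in q_pr q_gt3.
have [y /setIP[Gy nPy] oy] := Cauchy q_pr dvqN.
have qY : q.-group <[y]> by rewrite /pgroup -orderE oy pnat_id.
have cPY : P \subset 'C(<[y]>).
  have tC : t \in 'C_P(<[y]>).
    have /cards1P[z Iz] : #|involutions P| == 1%N by rewrite uniqI.
    have inI x : x \in P -> #[x] = 2 -> x = z.
      by move=> Px ox; apply/set1P; rewrite -Iz inE Px ox.
    rewrite inE Pt cent_cycle; apply/cent1P/commgP/conjg_fixP.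
    rewrite (inI t) // [LHS](inI) // -(inI t) // ?orderJ // memJ_norm //.
  (* The fixed points of y in P have order 2, 4 or 8, congruent to 8 modulo q; since q > 3 divides
     neither 6 nor 4, the order is 8. *)
  have := pgroup_fix_mod qY (_ : [acts <[y]>, on P | 'J]).
  rewrite astabsJ cycle_subG => /(_ nPy)/eqP; rewrite afixJ oP n2.
  have [i oC] := p_natP (pgroupS (subsetIl P 'C(<[y]>)) pP).
  have ntC : 'C_P(<[y]>) != 1 by apply/trivgPn; exists t; rewrite // -order_eq1 ot.
  have i_gt0 : 0 < i.
    by rewrite lt0n; apply: contraNneq ntC => i0; rewrite trivg_card1 oC i0.
  have leC : 2 ^ i <= 2 ^ 3.
    by have := subset_leq_card (subsetIl P 'C(<[y]>)); rewrite oC oP n2.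
  rewrite oC eqn_mod_dvd //.
  have [i_ge3 _ | i_lt3] := leqP 3 i.
    by apply/setIidPl/eqP; rewrite eqEcard subsetIl oP n2 oC leq_exp2l.
  have {i_gt0 i_lt3} [-> | ->] : i = 1%N \/ i = 2%N.
    by case: (i) i_gt0 i_lt3 => [|[|[|k]]] // _ _; [left | right].
    by rewrite dvdn_divisors // !inE => /or4P[] /eqP q_eq; rewrite q_eq in q_pr q_gt3.
  by rewrite dvdn_divisors // !inE => /or3P[] /eqP q_eq; rewrite q_eq in q_pr q_gt3.
have actG : [acts G, on 'Syl_2(G) | 'JG].
  by apply/actsP=> x Gx Q; rewrite !inE /= pHallJ.
have cSy : y \in 'C_G('Syl_2(G) | 'JG).
  have [Q0 /setIP[/setD1P[neQ0 SQ0] fixQ0]] :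
      exists Q0, Q0 \in 'Fix_('Syl_2(G) :\ P | 'JG)(<[y]>).
    apply/set0Pn/negP=> /eqP fix0.
    have := pgroup_fix_mod qY (_ : [acts <[y]>, on 'Syl_2(G) :\ P | 'JG]).
    rewrite fix0 cards0 cardS8 mod0n => fix8; move: q_gt3.
    have : q %| 2 ^ 3.
      rewrite /dvdn fix8 // cycle_subG (subsetP (norm_Sylow_acts SP)) //.
      by rewrite inE Gy.
    rewrite Euclid_dvdX // => /andP[/(dvdn_leq (ltn0Sn 1)) le_q2 _].
    by rewrite ltnNge (leq_trans le_q2).
  rewrite inE Gy; apply/astabP=> Q SQ; apply/val_inj/normP => /=.
  have [-> // | neQP] := eqVneq Q P.
  have : Q \in orbit 'JG P Q0 by rewrite orbS // in_setD1 neQP.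
  case/orbitP=> x Px <- /=; rewrite afixJG cycle_subG in fixQ0.
  have cxy : commute x y by apply: (centsP cPY) (cycle_id y).
  by apply/normP; rewrite -conjsgM cxy conjsgM (normP fixQ0).
(* The kernel of the action on the Sylow 2-subgroups contains y, so by simplicity it is G, and then
   G normalizes P. *)
have nsC : 'C_G('Syl_2(G) | 'JG) <| G.
  rewrite /normal subsetIl normsI ?normG //.
  exact: subset_trans actG (astab_norm _ _).
case: (simG' _ nsC) => [C1|CG].
  by move: cSy oy; rewrite /= C1 => /set1P->; rewrite order1 => q1; rewrite -q1 in q_pr.
case/negP: nnP; rewrite -afixJG; apply/afixP=> x Gx.
by apply: astab_act SP; move: Gx; rewrite -{1}CG => /setIP[].
Qed.

(** * The simple case and the induction *)

Lemma few_subgroups_simple_sol (gT : finGroupType) (G : {group gT}) :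
    simple G -> #|involutions G| <= 14 ->
    (forall H : {group gT}, H \proper G -> #|nontrivial_subgroups H| <= 14) ->
  solvable G.
Proof.
move=> simG leI leH; apply/negPn/negP=> nsolG.
have [ntG simG'] := simpleP _ simG.
have pr_p := pdiv_prime (_ : 1 < #|G|); rewrite cardG_gt1 in pr_p.
set p := pdiv #|G| in pr_p; have p_pr := pr_p ntG.
have minp q : prime q -> q %| #|G| -> p <= q.
  by move=> q_pr; apply: pdiv_min_dvd (prime_gt1 q_pr).
have [P sylP] := Sylow_exists p G; have [sPG pP _] := and3P sylP.
have SP : P \in 'Syl_p(G) by rewrite inE.
have ntP : P :!=: 1.
  rewrite -cardG_gt1 (card_Hall sylP) p_part_gt1 mem_primes p_pr cardG_gt0.
  exact: pdiv_dvd.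
have npG : ~~ p.-group G by apply: contra nsolG => /pgroup_sol.
have prP : P \proper G.
  by rewrite properEneq sPG andbT; apply: contra npG => /eqP<-.
have derG : G^`(1) = G.
  case: (simG' _ (der_normal 1 G)) => // G1.
  by case/negP: nsolG; apply: abelian_sol; apply/derG1P.
have sPG' : P \subset G^`(1) by rewrite derG.
have prN (D : {group gT}) : D \subset G -> p.-group D -> D :!=: 1 -> 'N_G(D) \proper G.
  move=> sDG pD ntD; rewrite properE subsetIl subsetI subxx /=.
  apply/negP=> nDG; case: (simG' D) => [|D1|DG]; first by rewrite /normal sDG.
    by rewrite D1 eqxx in ntD.
  by case/negP: npG; rewrite -DG.
have trP := Sylow_der1_trivg p_pr sylP minp _ _ sPG'.
have abV := Phi_quotient_abelem pP.
have [cycP | ncP] := boolP (cyclic P).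
  (* For cyclic P the Frattini quotient has order at most p, for any prime p. *)
  case/eqP: ntP; apply: trP; last exact: abelian_Sylow_fusion sylP (cyclic_abelian cycP).
  have cycV : cyclic (P / 'Phi(P)) by apply: quotient_cyclic.
  have [-> | ntV] := eqVneq (P / 'Phi(P)) 1; first by rewrite cards1 prime_gt0.
  by rewrite (cyclic_abelem_prime abV cycV ntV) leqnn.
have tiS := Sylow_TI p_pr sylP ncP (fun D sDG pD ntD => leH _ (prN D sDG pD ntD)).
have [p2 | oddp] := even_prime p_pr.
  rewrite p2 in SP tiS; have := TI_Sylow2_involutions simG nsolG SP ncP tiS.
  by rewrite ltnNge leI.
case/eqP: ntP; apply: trP => [|x g Px Gg Pxg].
  rewrite oddp [X in _ || X]leqNgt; apply/orP; right; apply/negP=> ltV.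
  have := card_nontrivial_subgroups_abelem abV _ ltV.
  rewrite odd_prime_gt2 // ltnNge => /(_ isT) /negP[].
  exact: leq_trans (card_nontrivial_subgroups_quotient (Phi_normal P)) (leH _ prP).
(* For x different from 1, [x ^ g] is a non-trivial element common to P and its conjugate by g, so
   the two coincide and g itself normalizes P. *)
have [-> | nt_x] := eqVneq x 1; first by exists 1; rewrite ?group1 // !conj1g.
exists g => //; rewrite inE Gg; apply/normP.
apply: congr_group; apply/eqP/negPn/negP => nePg.
have : x ^ g \in (P :^ g)%G :&: P by rewrite inE memJ_conjg Px.
rewrite tiS // ?inE ?pHallJ //=.
by move/eqP=> xg1; case/eqP: nt_x; apply: (@conjg_inj _ g); rewrite conj1g.
Qed.

Lemma nonsolvable_wide (gT : finGroupType) (G : {group gT}) :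
  ~~ solvable G -> wide G.
Proof.
have [n] := ubnP #|G|; elim: n gT G => // n IHn gT G /ltnSE-leGn nsolG.
have ntG : G :!=: 1 by apply: contraNneq nsolG => ->; apply: solvable1.
have [simG | nsimG] := boolP (simple G); last first.
  have [N /and3P[nsNG ntN prN]] : exists N : {group gT},
      [&& N <| G, N :!=: 1 & N \proper G].
    apply/existsP; apply: contraR nsimG => /existsPn noN; apply/simpleP.
    split=> // H nsHG; have := noN H; rewrite nsHG properEneq normal_sub //=.
    by rewrite andbT negb_and !negbK => /orP[/eqP|/eqP]; [left | right].
  have [solN | nsolN] := boolP (solvable N).
    apply: (wide_quotient nsNG); apply: IHn.
      by apply: leq_trans leGn; rewrite ltn_quotient ?normal_sub.
    by apply: contra nsolG => solGN; rewrite (series_sol nsNG) solN.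
  apply: (wide_proper prN); apply: wide_nontrivial_subgroups; apply: IHn nsolN.
  exact: leq_trans (proper_card prN) leGn.
have [ltI | leI] := ltnP 14 #|involutions G|; first exact: wide_involutions.
have [/existsP[H /andP[prH ltH]] | /existsPn leH] :=
  boolP [exists H : {group gT}, (H \proper G) && (14 < #|nontrivial_subgroups H|)].
  exact: wide_proper prH ltH.
case/negP: nsolG; apply: few_subgroups_simple_sol => // H prH.
by have := leH H; rewrite prH /= -leqNgt.
Qed.

Theorem theorem5p4 (gT : finGroupType) (G : {group gT})
    (has_edge : exists H K : {group gT}, dsg_adj G H K)
    (alpha_le14 : independence_number (dsg_vertices G) (dsg_adj G) <= 14) :
  solvable G.
Proof.
apply/negPn/negP=> /nonsolvable_wide/wide_independence.
by rewrite ltnNge alpha_le14.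
Qed.
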